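(* If $E_0=\{x\in\mathbb{H}^1:\|x\|_\rho<1\}$ is the unit Korányi ball centered at $o=(0,0,0)$, then under the horizontal inverse mean curvature flow starting from $E_0$ the evolving surface $M_t=\partial E_t$ is given by $$M_t=\{x\in\mathbb{H}^1:\ \|x\|_\rho=e^{\frac13t}\},\qquad \|x\|_\rho=\left[(x_1^2+x_2^2)^2+16x_3^2\right]^{1/4}.$$
   Context: The first Heisenberg group $\mathbb{H}^1$ is $\mathbb{R}^3$ with the product $(x_1,x_2,x_3)\cdot(y_1,y_2,y_3)=(x_1+y_1,x_2+y_2,x_3+y_3+\frac12(x_1y_2-y_1x_2))$ and left-invariant fields $X_1=\partial_{x_1}-\frac{x_2}{2}\partial_{x_3}$, $X_2=\partial_{x_2}+\frac{x_1}{2}\partial_{x_3}$, $T=\partial_{x_3}$; $\langle\cdot,\cdot\rangle$ is the Riemannian metric making $X_1,X_2,T$ orthonormal. $\nabla_0u=(X_1u)X_1+(X_2u)X_2$, $|\nabla_0u|^2=(X_1u)^2+(X_2u)^2$, $\operatorname{div}_0(aX_1+bX_2)=X_1a+X_2b$. For a $C^1$ surface $M$ with outward normal $V$, $V_0=V-\langle V,T\rangle T$ and $\Sigma(M)=\{V_0=0\}$ is the set of characteristic points; off $\Sigma(M)$, $\nu=V/|V|$, $\nu_0=V_0/|V_0|$, $H_0=\operatorname{div}_0(\nu_0)$. The horizontal inverse mean curvature flow is the evolution $\langle\partial x/\partial t,\nu\rangle=H_0^{-1}\langle\nu_0,\nu\rangle$ at points $x\in M_t\setminus\Sigma(M_t)$.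 In level-set form, with $E_t=\{u<t\}$ and $M_t=\partial E_t=\{u=t\}$, surfaces evolve by this flow if $\operatorname{div}_0\left(\nabla_0u/|\nabla_0u|\right)=|\nabla_0u|$ at every $x\in M_t\setminus\Sigma(M_t)$ (where $\Sigma(M_t)$ is the set of points of $M_t$ with $|\nabla_0u|=0$). *)

(* Defs.v *)
From HB Require Import structures.
From mathcomp Require Import all_boot all_order all_algebra.
From mathcomp Require Import all_classical all_reals all_analysis.

Set Implicit Arguments.
Unset Strict Implicit.
Unset Printing Implicit Defensive.

Import Order.TTheory GRing.Theory Num.Theory.
Import numFieldNormedType.Exports.

Local Open Scope classical_set_scope.
Local Open Scope ring_scope.

(* The underlying manifold of the first Heisenberg group is R^3, represented
   by row vectors; the coordinate x_k of the literature is [x 0 (k-1)]. *)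
Notation heis R := 'rV[R]_3.

Definition frontier (T : topologicalType) (A : set T) : set T :=
  closure A `\` interior A.

(* In finite dimension, continuity of all directional derivatives x |-> df_x(v)
   is continuity of the differential x |-> df_x. *)
Fixpoint Ck_on (R : realType) (V : normedModType R) (k : nat)
    (U : set V) (f : V -> R) : Prop :=
  if k is k'.+1 then
    (forall x, U x -> differentiable f x) /\
    (forall v : V, Ck_on k' U ('D_v f))
  else forall x, U x -> {for x, continuous f}.

Section Heisenberg.
Variable R : realType.
Implicit Types (x : heis R) (u a b : heis R -> R).

Definition vec3 (p q r : R) : heis R := \row_(j < 3) [:: p; q; r]`_j.

(* The left-invariant frame of the group law
   x . y = (x1 + y1, x2 + y2, x3 + y3 + (x1 y2 - y1 x2) / 2),
   each field being given by its coefficients on d/dx1, d/dx2, d/dx3. *)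
Definition X1 x : heis R := vec3 1 0 (- (x 0 1 / 2)).
Definition X2 x : heis R := vec3 0 1 (x 0 0 / 2).

(* A horizontal field a X1 + b X2 is given by its components (a, b). *)
Definition hgrad1 u x : R := 'D_(X1 x) u x.
Definition hgrad2 u x : R := 'D_(X2 x) u x.

Definition hgrad_norm u x : R :=
  Num.sqrt (hgrad1 u x ^+ 2 + hgrad2 u x ^+ 2).

Definition hdiv a b x : R := 'D_(X1 x) a x + 'D_(X2 x) b x.

Definition koranyi x : R :=
  ((x 0 0 ^+ 2 + x 0 1 ^+ 2) ^+ 2 + 16 * x 0 2 ^+ 2) `^ (1 / 4).

Definition E_ u (t : R) : set (heis R) := [set x | u x < t].

Definition M_ u (t : R) : set (heis R) := frontier (E_ u t).

Definition Sigma_ u (t : R) : set (heis R) :=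
  M_ u t `&` [set x | hgrad_norm u x = 0].

(* [u] is the level-set function of a classical horizontal inverse mean
   curvature flow, defined for all t >= 0, of C^1 surfaces bounding bounded
   open sets and starting from [E0]. Only the values of [u] on the complement
   of [E0] carry information. *)
Definition HIMCF_from (E0 : set (heis R)) u : Prop :=
  [/\ E_ u 0 = E0,
      exists U : set (heis R),
        [/\ open U, [set x | 0 <= u x] `<=` U & Ck_on 2 U u],
      forall x, 0 <= u x -> exists v : heis R, 'D_v u x != 0,
      forall t, 0 <= t ->
        bounded_set (E_ u t) /\ M_ u t = [set x | u x = t]
    & forall t, 0 <= t -> forall x, (M_ u t `\` Sigma_ u t) x ->
        hdiv (fun y => hgrad1 u y / hgrad_norm u y)
             (fun y => hgrad2 u y / hgrad_norm u y) x
        = hgrad_norm u x].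

End Heisenberg.

(* Main.v *)
Require Import Defs.
From mathcomp Require Import all_boot all_order all_algebra.
From mathcomp Require Import all_classical all_reals all_analysis.
From mathcomp Require Import ring lra.

Import Order.TTheory GRing.Theory Num.Theory.
Import numFieldNormedType.Exports.

Local Open Scope classical_set_scope.
Local Open Scope ring_scope.

Set Implicit Arguments.
Unset Strict Implicit.
Unset Printing Implicit Defensive.

(** Write [s] for the square of the distance to the vertical axis, [z] for the
    height, and [N = s^2 + 16 z^2] for the fourth power of the Koranyi norm.
    The claim is that [N = exp (4 u / 3)] outside the unit ball for every
    level-set function [u] of the flow, and that [u = (3/4) ln N] is one.

    Freezing the components [(a, b)] of the horizontal gradient of [u] at a
    noncharacteristic point, let [W = - b X1 + a X2].  The integral curve of
    this left-invariant field through the point is a straight line of R^3, and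
    the horizontal curvature of the level set is [u_WW / |(a, b)|^3], where
    [u_WW] is the plain second derivative of [u] along that line
    ([hdiv_unit_hgrad]).  The flow equation thus reads [u_WW = |(a, b)|^4],
    while [u_W = 0].  For [u = (3/4) ln N] this is a computation
    ([koranyi_flow]).

    Uniqueness is a comparison argument, and its difficulty is the vertical
    axis, where the level sets of [N] have their characteristic points: the
    flow equation says nothing there and the equation is degenerate.  The
    comparison is therefore made not with [N] but with the barriers
    [K = N + d sqrt s], which are conical along the axis.  The sign of [d]
    works for both purposes at once.  A differentiable function cannot touch
    the cone on the axis from the side on which [K] has its edge
    ([no_touching_on_axis]).  Off the axis [ln K] is a super- or subsolution of
    the equation of [ln N], according to the sign of [d], by a
    polynomial inequality ([barrier_bend_le], [barrier_bend_ge]); the two second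
    derivatives along [W] at a contact point then contradict each other
    ([no_touching_off_axis]).

    With [p = exp (- 4 u / 3)], the function [K (e + p)], with [d < 0], and the
    function [(e + 1 / K) / p], with [d > 0], tend to infinity because of
    [e > 0], so that each would have an interior minimum if [N p] were
    somewhere less, respectively greater, than 1.  At such a minimum [p]
    touches [c / K] up to a constant whose sign, given by [e], makes the
    contact strict ([HIMCF_lower], [HIMCF_upper]). *)

(** * Directional derivatives *)
Section DirectionalCalculus.
Context {R : realType} {V : normedModType R}.
Implicit Types (f g : V -> R) (x v w : V) (a b t : R).

(** The two lemmas below carry the calculus of one real variable (chain rule,
    mean value theorem) over to directional derivatives. *)
Lemma is_derive_line f x v t a :
  is_derive (t *: v + x) v f a ->
  is_derive t 1 (fun h : R => f (h *: v + x)) a.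
Proof.
have E : (fun h : R => h^-1 *: ((f \o shift (t *: v + x)) (h *: v) - f (t *: v + x)))
       = (fun h : R => h^-1 *: (((fun k : R => f (k *: v + x)) \o shift t) (h *: (1 : R))
           - f (t *: v + x))).
  by apply/funext => h /=; rewrite scalerDl /GRing.scale/= mulr1 addrA.
by move=> [df dE]; split; [move: df; rewrite /derivable E|rewrite -dE /derive E].
Qed.

Lemma line_is_derive f x v a :
  is_derive (0 : R) 1 (fun h : R => f (h *: v + x)) a -> is_derive x v f a.
Proof.
have E : (fun h : R => h^-1 *: ((f \o shift x) (h *: v) - f x))
       = (fun h : R => h^-1 *: (((fun k : R => f (k *: v + x)) \o shift 0) (h *: (1 : R))
           - f (0 *: v + x))).
  by apply/funext => h /=; rewrite addr0 scale0r add0r /GRing.scale/= mulr1.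
by move=> [df dE]; split; [rewrite /derivable E|rewrite -dE /derive E].
Qed.

Lemma der_cst a x v : is_derive x v (fun=> a) (0 : R).
Proof. exact: is_derive_cst. Qed.

Lemma der_add f g x v a b : is_derive x v f a -> is_derive x v g b ->
  is_derive x v (fun y => f y + g y) (a + b).
Proof. by move=> fa gb; exact: (is_deriveD fa gb). Qed.

Lemma der_opp f x v a : is_derive x v f a -> is_derive x v (fun y => - f y) (- a).
Proof. by move=> fa; exact: (is_deriveN fa). Qed.

Lemma der_mul f g x v a b : is_derive x v f a -> is_derive x v g b ->
  is_derive x v (fun y => f y * g y) (a * g x + f x * b).
Proof.
move=> fa gb; have := is_deriveM fa gb.
by rewrite /GRing.scale/= [g x * a]mulrC [X in is_derive _ _ _ X]addrC.
Qed.

Lemma der_exp f n x v a : is_derive x v f a ->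
  is_derive x v (fun y => f y ^+ n.+1) (n.+1%:R * f x ^+ n * a).
Proof.
by move=> fa; have := is_deriveX n.+1 fa; rewrite exprfctE.
Qed.

Lemma der_comp (F : R -> R) f x v a b : is_derive (f x) 1 F b ->
  is_derive x v f a -> is_derive x v (fun y => F (f y)) (b * a).
Proof.
move=> Fb fa; apply: line_is_derive.
apply: (@is_derive1_comp R F (fun h : R => f (h *: v + x))).
  by rewrite scale0r add0r.
by apply: is_derive_line; rewrite scale0r add0r.
Qed.

Lemma der_inv f x v a : f x != 0 -> is_derive x v f a ->
  is_derive x v (fun y => (f y)^-1) (- a / f x ^+ 2).
Proof.
move=> f0 [df <-]; split; first exact: derivableV.
by rewrite deriveV// /GRing.scale/= mulNr mulrC mulNr.
Qed.

Lemma der_diff f x v : differentiable f x -> is_derive x v f ('D_v f x).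
Proof. by move=> df; apply: derivableP; exact: diff_derivable. Qed.

Lemma derive_lin f x v w a b : differentiable f x ->
  'D_(a *: v + b *: w) f x = a * 'D_v f x + b * 'D_w f x.
Proof. by move=> df; rewrite !deriveE// linearP linearZ. Qed.

Lemma der_eq f x v a b : is_derive x v f a -> a = b -> is_derive x v f b.
Proof. by move=> fa <-. Qed.

Lemma derE f x v a : is_derive x v f a -> 'D_v f x = a.
Proof. by case. Qed.

End DirectionalCalculus.

(* [is_derive] is a class: instance search on the subgoals would produce
   derivatives in a scaled-product form that [ring] does not read, hence
   [notypeclasses refine].  Hypotheses are used only when they match
   syntactically, since unification would unfold the functions. *)
Ltac der_atom := fail.
Ltac der_hyp := match goal with
  | H : is_derive _ _ ?f _ |- @is_derive _ ?V _ _ _ ?g _ =>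
      let f' := eval cbv beta in (fun y : V => f y) in
      let g' := eval cbv beta in (fun y : V => g y) in
      constr_eq f' g'; exact H
  end.
Ltac der_step := lazymatch goal with
  | |- is_derive _ _ (fun _ => ?c) _ => notypeclasses refine (der_cst _ _ _)
  | |- is_derive _ _ (fun y => @?f y + @?g y) _ =>
      notypeclasses refine (@der_add _ _ f g _ _ _ _ _ _)
  | |- is_derive _ _ (fun y => - @?f y) _ =>
      notypeclasses refine (@der_opp _ _ f _ _ _ _)
  | |- is_derive _ _ (fun y => (@?f y)^-1) _ =>
      notypeclasses refine (@der_inv _ _ f _ _ _ _ _)
  | |- is_derive _ _ (fun y => @?f y * @?g y) _ =>
      notypeclasses refine (@der_mul _ _ f g _ _ _ _ _ _)
  | |- is_derive _ _ (fun y => (@?f y) ^+ _.+1) _ =>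
      notypeclasses refine (@der_exp _ _ f _ _ _ _ _)
  | |- is_derive _ _ (fun y => Num.sqrt (@?f y)) _ =>
      notypeclasses refine (@der_comp _ _ _ f _ _ _ _ (is_derive1_sqrt _) _)
  | |- is_derive _ _ (fun y => expR (@?f y)) _ =>
      notypeclasses refine (@der_comp _ _ _ f _ _ _ _ (is_derive_expR _) _)
  | |- is_derive _ _ (fun y => ln (@?f y)) _ =>
      notypeclasses refine (@der_comp _ _ _ f _ _ _ _ (is_derive1_ln _) _)
  end.
Ltac der := notypeclasses refine (der_eq _ _);
  [repeat (first [der_hyp | der_step | der_atom])|cbv beta].

Lemma der_coord (R : realType) (x v : heis R) (i : 'I_3) :
  is_derive x v (fun y => y 0 i) (v 0 i).
Proof.
apply: line_is_derive.
have -> : (fun h : R => (h *: v + x) 0 i) = (fun h : R => h * v 0 i + x 0 i).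
  by apply/funext => h; rewrite !mxE.
have e : is_derive (0 : R) (1 : R) (fun h : R => h) (1 : R) := is_derive_id _ _.
by der; ring.
Qed.
Ltac der_atom ::= lazymatch goal with
  |- is_derive _ _ (fun y => fun_of_matrix y _ _) _ => notypeclasses refine (der_coord _ _ _)
  end.

(* [ring] would compare two directional derivatives by unfolding them. *)
Ltac gen_derive := repeat match goal with
  |- context [@derive ?a ?b ?c ?f ?x ?v] => generalize (@derive a b c f x v); intro
  end.

Section ExtremumTests.
Context {R : realType}.

Lemma near_right (x : R) (P : R -> Prop) :
  (\forall t \near x, P t) -> \forall t \near x^'+, P t.
Proof. exact: cvg_within. Qed.

Lemma der_right (f : R -> R) (a : R) : is_derive (0 : R) (1 : R) f a ->
  (fun t : R => t^-1 * (f t - f 0)) @ 0^'+ --> a.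
Proof.
move=> [df <-].
have -> : (fun t : R => t^-1 * (f t - f 0))
        = (fun t : R => t^-1 *: ((f \o shift 0) (t *: (1 : R)) - f 0)).
  by apply/funext => t; rewrite /= addr0 /GRing.scale/= mulr1.
have dnr : (0 : R)^'+ `=>` 0^'.
  move=> A; rewrite /at_right /dnbhs /within/=; apply: filterS => t At t0.
  by apply: At; rewrite gt_eqF.
exact: (cvg_trans (cvg_app _ dnr) df).
Qed.

(** The condition is one-sided because a barrier has a corner on the vertical
    axis: along a horizontal line through it, it is smooth on each side only. *)
Lemma right_min_derive_ge0 (f : R -> R) (a : R) : is_derive (0 : R) (1 : R) f a ->
  (\forall t \near (0 : R)^'+, f 0 <= f t) -> 0 <= a.
Proof.
move=> /der_right fa fmin; rewrite -(cvg_lim _ fa)//.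
apply: limr_ge; first exact/cvg_ex/(ex_intro _ a).
near=> t; have t0 : 0 < t by [].
by apply: mulr_ge0; [rewrite invr_ge0 ltW|rewrite subr_ge0; near: t].
Unshelve. all: by end_near. Qed.

Context {V : normedModType R}.
Implicit Types (h dh : V -> R).

Lemma near_line (P : V -> Prop) (x v : V) :
  (\forall y \near x, P y) -> \forall t \near (0 : R), P (t *: v + x).
Proof.
have c : (fun t : R => t *: v + x) @ (0 : R) --> x.
  rewrite -[X in _ --> X]add0r -[X in _ --> X + _](scale0r v).
  by apply: cvgD; [exact: scalel_continuous|exact: cvg_cst].
exact: c.
Qed.

Lemma min_derive_eq0 h (x v : V) (a : R) : is_derive x v h a ->
  (\forall y \near x, h x <= h y) -> a = 0.
Proof.
have side w b : is_derive x w h b -> (\forall y \near x, h x <= h y) -> 0 <= b.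
  move=> hb hmin; apply: (@right_min_derive_ge0 (fun t => h (t *: w + x))).
    by apply: is_derive_line; rewrite scale0r add0r.
  rewrite scale0r add0r; apply: near_right.
  exact: (@near_line (fun y => h x <= h y)).
move=> ha hmin; apply/eqP; rewrite eq_le (side v)// andbT -oppr_ge0.
apply: (side (- v)) => //; apply: line_is_derive.
pose g (t : R) := h (t *: v + x).
have -> : (fun t : R => h (t *: - v + x)) = (fun t : R => g (- t)).
  by apply/funext => t; rewrite /g scalerN scaleNr.
rewrite -[- a]mulr1 mulNr -mulrN; apply: (@is_derive1_comp R g -%R).
  by rewrite oppr0; apply: is_derive_line; rewrite scale0r add0r.
Qed.

(** If the second derivative were negative, [dh] would be negative just after
    [x] on the line, and the mean value theorem would make [h] decrease. *)
Lemma min_derive2_ge0 h dh (x v : V) (a : R) :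
  (\forall y \near x, is_derive y v h (dh y)) -> is_derive x v dh a ->
  (\forall y \near x, h x <= h y) -> 0 <= a.
Proof.
move=> hdh dha hmin.
have hx : is_derive x v h (dh x) := nbhs_singleton hdh.
have dh0 : dh x = 0 := min_derive_eq0 hx hmin.
rewrite leNgt; apply/negP => a0.
pose g (t : R) := h (t *: v + x); pose dg (t : R) := dh (t *: v + x).
have dga : is_derive (0 : R) (1 : R) dg a.
  by apply: is_derive_line; rewrite scale0r add0r.
have dg0 : dg 0 = 0 by rewrite /dg scale0r add0r.
have dgneg : \forall t \near (0 : R)^'+, dg t < 0.
  have /cvgr_lt /(_ _ a0) H := der_right dga; near=> t.
  have t0 : 0 < t by [].
  have : t^-1 * (dg t - dg 0) < 0 by near: t.
  by rewrite dg0 subr0 pmulr_rlt0// invr_gt0.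
have /nbhs_ballP[e/= e0 gdg] := near_line v hdh.
have := dgneg; rewrite /at_right near_withinE => /nbhs_ballP[e'/= e'0 dgn].
have gmin := near_right (near_line v hmin).
near (0 : R)^'+ => b.
have b0 : 0 < b by [].
have be : b < e by near: b; exact: nbhs_right_lt.
have be' : b < e' by near: b; exact: nbhs_right_lt.
have : g 0 <= g b by rewrite {1}/g scale0r add0r; near: b.
have gdg' t : 0 <= t <= b -> is_derive t (1 : R) g (dg t).
  move=> /andP[t0 tb]; apply: is_derive_line; apply: gdg.
  by rewrite /ball/= sub0r normrN ger0_norm// (le_lt_trans tb).
have [t|t|c] := @MVT R g dg 0 b b0.
- by rewrite in_itv => /andP[/ltW t0 /ltW tb]; apply: gdg'; rewrite t0.
- apply: derivable_within_continuous t => t; rewrite in_itv/= => tb.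
  by have [] := gdg' t tb.
rewrite in_itv/= => /andP[c0 cb] gE; rewrite leNgt -subr_lt0 gE subr0.
rewrite pmulr_llt0// dgn//.
by rewrite /ball/= sub0r normrN ger0_norm ?ltW// (lt_trans cb).
Unshelve. all: by end_near. Qed.

End ExtremumTests.

(** * Horizontal curvature as a second derivative along a line *)
Section HorizontalCurvature.
Context {R : realType}.
Implicit Types (x y v w : heis R) (u : heis R -> R).

Lemma vec3E (p q r : R) : vec3 p q r 0 0 = p /\ vec3 p q r 0 1 = q /\ vec3 p q r 0 2 = r.
Proof. by rewrite !mxE. Qed.

Lemma heis_eq x y : x 0 0 = y 0 0 -> x 0 1 = y 0 1 -> x 0 2 = y 0 2 -> x = y.
Proof.
move=> e0 e1 e2; apply/rowP => i.
have : i \in [:: 0; 1; 2] by case: i => [[|[|[|]]]].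
by rewrite !inE => /or3P[] /eqP ->.
Qed.

Lemma heis_basis v :
  v = v 0 0 *: vec3 1 0 0 + 1 *: (v 0 1 *: vec3 0 1 0 + v 0 2 *: vec3 0 0 1).
Proof. by apply: heis_eq; rewrite !mxE/=; ring. Qed.

Lemma derive_basis u x v : differentiable u x ->
  'D_v u x = v 0 0 * 'D_(vec3 1 0 0) u x + v 0 1 * 'D_(vec3 0 1 0) u x
             + v 0 2 * 'D_(vec3 0 0 1) u x.
Proof. by move=> du; rewrite {1}[v]heis_basis !derive_lin// mul1r addrA. Qed.

(** The direction tangent to the level set, with the components of the
    horizontal gradient frozen at [x]. *)
Definition characteristic_direction u x : heis R :=
  - hgrad2 u x *: X1 x + hgrad1 u x *: X2 x.

(** Differentiating the normalized gradient gives the horizontal Hessian on the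
    rotated gradient.  Replacing the field of directions by the constant vector
    [W] changes nothing, because the vertical component of the rotated field is
    constant along [W]. *)
Lemma hdiv_unit_hgrad u x : (\forall y \near x, differentiable u y) ->
  (forall v, differentiable ('D_v u) x) -> 0 < hgrad_norm u x ->
  let W := characteristic_direction u x in
  hdiv (fun y => hgrad1 u y / hgrad_norm u y) (fun y => hgrad2 u y / hgrad_norm u y) x
  = 'D_W ('D_W u) x / hgrad_norm u x ^+ 3.
Proof.
move=> du d2u n0 /=; rewrite /characteristic_direction.
(* Every function and vector is made abstract, so that no tactic compares
   matrices or directional derivatives by unfolding them. *)
have [U1 E1] : exists U, U = 'D_(vec3 1 0 0) u by exact: (ex_intro _ _ erefl).
have [U2 E2] : exists U, U = 'D_(vec3 0 1 0) u by exact: (ex_intro _ _ erefl).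
have [U3 E3] : exists U, U = 'D_(vec3 0 0 1) u by exact: (ex_intro _ _ erefl).
have [d1 d2 d3] : [/\ differentiable U1 x, differentiable U2 x & differentiable U3 x].
  by rewrite E1 E2 E3; split; exact: d2u.
have basisE y v : differentiable u y ->
    'D_v u y = v 0 0 * U1 y + v 0 1 * U2 y + v 0 2 * U3 y.
  by move=> /derive_basis ->; rewrite E1 E2 E3.
have basis2E (U : heis R -> R) v : differentiable U x -> 'D_v U x
    = v 0 0 * 'D_(vec3 1 0 0) U x + v 0 1 * 'D_(vec3 0 1 0) U x
      + v 0 2 * 'D_(vec3 0 0 1) U x by exact: derive_basis.
have [e1 e1E] : exists e : heis R, e = vec3 1 0 0 by eexists.
have [e2 e2E] : exists e : heis R, e = vec3 0 1 0 by eexists.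
have [e3 e3E] : exists e : heis R, e = vec3 0 0 1 by eexists.
rewrite -e1E -e2E -e3E in basis2E; clear E1 E2 E3 e1E e2E e3E.
have da v : is_derive x v (hgrad1 u)
    ('D_v U1 x - v 0 1 / 2 * U3 x - x 0 1 / 2 * 'D_v U3 x).
  apply: (@near_eq_is_derive _ _ _ (fun y => U1 y + - (y 0 1 / 2) * U3 y)).
    apply: filterS du => y duy; rewrite /hgrad1 basisE//.
    by rewrite !(vec3E _ _ _).1 !(vec3E _ _ _).2.1 !(vec3E _ _ _).2.2 mul1r mul0r addr0.
  have f1 := der_diff v d1; have f3 := der_diff v d3.
  by der; gen_derive; ring.
have db v : is_derive x v (hgrad2 u)
    ('D_v U2 x + v 0 0 / 2 * U3 x + x 0 0 / 2 * 'D_v U3 x).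
  apply: (@near_eq_is_derive _ _ _ (fun y => U2 y + (y 0 0 / 2) * U3 y)).
    apply: filterS du => y duy; rewrite /hgrad2 basisE//.
    by rewrite !(vec3E _ _ _).1 !(vec3E _ _ _).2.1 !(vec3E _ _ _).2.2 mul1r mul0r add0r.
  have f2 := der_diff v d2; have f3 := der_diff v d3.
  by der; gen_derive; ring.
have dw v : 'D_v ('D_v u) x = v 0 0 * 'D_v U1 x + v 0 1 * 'D_v U2 x + v 0 2 * 'D_v U3 x.
  apply: derE; apply: (@near_eq_is_derive _ _ _
      (fun y => v 0 0 * U1 y + v 0 1 * U2 y + v 0 2 * U3 y)).
    by apply: filterS du => y duy; rewrite basisE.
  have f1 := der_diff v d1; have f2 := der_diff v d2; have f3 := der_diff v d3.
  by der; gen_derive; ring.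
rewrite dw /hdiv; clear dw basisE.
have nE y : hgrad_norm u y = Num.sqrt (hgrad1 u y ^+ 2 + hgrad2 u y ^+ 2) by [].
move: (hgrad_norm u) (hgrad1 u) (hgrad2 u) nE n0 da db => N A B /funext NE n0 da db.
have [x10 [x11 x12]] : X1 x 0 0 = 1 /\ X1 x 0 1 = 0 /\ X1 x 0 2 = - (x 0 1 / 2) := vec3E _ _ _.
have [x20 [x21 x22]] : X2 x 0 0 = 0 /\ X2 x 0 1 = 1 /\ X2 x 0 2 = x 0 0 / 2 := vec3E _ _ _.
move: (X1 x) (X2 x) x10 x11 x12 x20 x21 x22 => v1 v2 x10 x11 x12 x20 x21 x22.
have [w wE] : exists w, w = - B x *: v1 + A x *: v2 by eexists.
have w0 : w 0 0 = - B x by rewrite wE !mxE x10 x20; ring.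
have w1 : w 0 1 = A x by rewrite wE !mxE x11 x21; ring.
have w2 : w 0 2 = (B x * x 0 1 + A x * x 0 0) / 2 by rewrite wE !mxE x12 x22; field.
rewrite -wE; clear wE.
have n2 : N x ^+ 2 = A x ^+ 2 + B x ^+ 2 by rewrite NE sqr_sqrtr// addr_ge0 ?sqr_ge0.
have nn0 : N x != 0 by rewrite gt_eqF.
have n2gt0 : 0 < A x ^+ 2 + B x ^+ 2 by rewrite -n2 exprn_gt0.
have dn v a b : is_derive x v A a -> is_derive x v B b ->
    is_derive x v N ((A x * a + B x * b) / N x).
  move=> ea eb; rewrite {1}NE; der => //.
  have -> : Num.sqrt (A x ^+ 2 + B x ^+ 2) = N x by rewrite NE.
  by move: (A x) (B x) (N x) nn0 => *; field.
have dq (f : heis R -> R) v df a b : is_derive x v A a -> is_derive x v B b ->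
    is_derive x v f df -> 'D_v (fun y => f y / N y) x
    = df / N x - f x * (A x * a + B x * b) / N x ^+ 3.
  move=> ea eb fd; have e := dn _ _ _ ea eb; apply: derE; der => //.
  by move: (A x) (B x) (N x) (f x) nn0 => *; field.
rewrite (dq A v1 _ _ _ (da v1) (db v1) (da v1)).
rewrite (dq B v2 _ _ _ (da v2) (db v2) (db v2)).
rewrite (basis2E U1 v1 d1) (basis2E U2 v1 d2) (basis2E U3 v1 d3).
rewrite (basis2E U1 v2 d1) (basis2E U2 v2 d2) (basis2E U3 v2 d3).
rewrite (basis2E U1 w d1) (basis2E U2 w d2) (basis2E U3 w d3).
rewrite x10 x11 x12 x20 x21 x22 w0 w1 w2.
have comb (p q p' q' : R) : p / N x - q / N x ^+ 3 + (p' / N x - q' / N x ^+ 3)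
    = ((p + p') * (A x ^+ 2 + B x ^+ 2) - (q + q')) / N x ^+ 3.
  by rewrite -n2; move: (N x) nn0 => *; field.
rewrite comb; congr (_ / _); gen_derive.
by move: (U1 x) (U2 x) (U3 x) (x 0 0) (x 0 1) (A x) (B x) => *; field.
Qed.

End HorizontalCurvature.

(** * Conical barriers *)
Section PerturbedGauge.
Context {R : realType}.
Implicit Types (x y v w : heis R) (d r : R).

Definition hsq x : R := x 0 0 ^+ 2 + x 0 1 ^+ 2.
Definition gauge4 x : R := hsq x ^+ 2 + 16 * x 0 2 ^+ 2.
(** The Koranyi gauge with an edge of slope [d] along the vertical axis. *)
Definition barrier d x : R := gauge4 x + d * Num.sqrt (hsq x).

(** The derivative of [barrier d] with respect to [hsq]. *)
Definition slope d x : R := 2 * hsq x + d / (2 * Num.sqrt (hsq x)).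
(** Off the axis [barrier1] and [barrier2] are the horizontal derivatives of
    the barrier and [hsq * barrier_steep] is the square of its horizontal gradient;
    [hsq * barrier_bend] is its second derivative along the rotated gradient. *)
Definition barrier1 d x : R := 2 * slope d x * x 0 0 - 16 * x 0 1 * x 0 2.
Definition barrier2 d x : R := 2 * slope d x * x 0 1 + 16 * x 0 0 * x 0 2.
Definition barrier_steep d x : R := 4 * slope d x ^+ 2 + 256 * x 0 2 ^+ 2.
Definition barrier_bend d x : R :=
  12 * hsq x * barrier_steep d x + 8 * (d / (2 * Num.sqrt (hsq x))) * slope d x ^+ 2.

Definition dbarrier d v x : R :=
  slope d x * (2 * (x 0 0 * v 0 0 + x 0 1 * v 0 1)) + 32 * x 0 2 * v 0 2.

Lemma hsq_ge0 x : 0 <= hsq x.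
Proof. by rewrite addr_ge0 ?sqr_ge0. Qed.

Lemma der_hsq x v : is_derive x v hsq (2 * (x 0 0 * v 0 0 + x 0 1 * v 0 1)).
Proof. by rewrite /hsq; der; ring. Qed.

Lemma der_gauge4 x v :
  is_derive x v gauge4 (2 * hsq x * (2 * (x 0 0 * v 0 0 + x 0 1 * v 0 1)) + 32 * x 0 2 * v 0 2).
Proof. by have e := der_hsq x v; rewrite /gauge4; der; ring. Qed.

Lemma der_barrier d x v : 0 < hsq x -> is_derive x v (barrier d) (dbarrier d v x).
Proof.
move=> s0; have e := der_hsq x v; have e' := der_gauge4 x v.
rewrite /barrier; der => //; rewrite /dbarrier /slope; field.
by rewrite gt_eqF// sqrtr_gt0.
Qed.

Lemma barrier_grad d x : 0 < hsq x ->
  hgrad1 (barrier d) x = barrier1 d x /\ hgrad2 (barrier d) x = barrier2 d x.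
Proof.
move=> s0; split; rewrite /hgrad1 /hgrad2 (derE (der_barrier _ _ s0)) /dbarrier !mxE/=.
  by rewrite /barrier1; field.
by rewrite /barrier2; field.
Qed.

Lemma barrier_grad_sq d x : barrier1 d x ^+ 2 + barrier2 d x ^+ 2 = hsq x * barrier_steep d x.
Proof. by rewrite /barrier1 /barrier2 /barrier_steep /hsq; ring. Qed.

(** The scalar [r] allows for the rotated gradient of any function whose
    horizontal gradient is proportional to that of the barrier. *)
Lemma der2_barrier d r x w : 0 < hsq x ->
  w = - (r * barrier2 d x) *: X1 x + (r * barrier1 d x) *: X2 x ->
  dbarrier d w x = 0 /\
  is_derive x w (dbarrier d w) (r ^+ 2 * hsq x * barrier_bend d x).
Proof.
move=> s0 wE.
have w0 : w 0 0 = - (r * barrier2 d x) by rewrite wE !mxE/=; ring.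
have w1 : w 0 1 = r * barrier1 d x by rewrite wE !mxE/=; ring.
have w2 : w 0 2 = r * (slope d x * hsq x).
  by rewrite wE !mxE/= /barrier1 /barrier2 /hsq; field.
have q0 : 0 < Num.sqrt (hsq x) by rewrite sqrtr_gt0.
split.
  by rewrite /dbarrier w0 w1 w2 /barrier1 /barrier2 /hsq; ring.
have e := der_hsq x w; rewrite /dbarrier /slope; der => //.
  by rewrite mulf_neq0 ?gt_eqF.
have E1 : x 0 0 * w 0 0 + x 0 1 * w 0 1 = - (16 * r * hsq x * x 0 2).
  by rewrite w0 w1 /barrier1 /barrier2 /hsq; ring.
have E2 : w 0 0 * w 0 0 + w 0 1 * w 0 1 = r ^+ 2 * (hsq x * barrier_steep d x).
  by rewrite w0 w1 -barrier_grad_sq; ring.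
have sE : hsq x = Num.sqrt (hsq x) ^+ 2 by rewrite sqr_sqrtr ?hsq_ge0.
have gE : slope d x = 2 * hsq x + d / (2 * Num.sqrt (hsq x)) by [].
rewrite -gE.
set q := Num.sqrt _ in q0 sE gE *; set g := slope d x in w2 gE E2 *.
transitivity (((2 - d / (4 * q ^+ 3)) * (2 * (x 0 0 * w 0 0 + x 0 1 * w 0 1))
    * (2 * (x 0 0 * w 0 0 + x 0 1 * w 0 1)))
  + g * (2 * (w 0 0 * w 0 0 + w 0 1 * w 0 1)) + 32 * w 0 2 * w 0 2).
  by field; rewrite gt_eqF.
rewrite E1 E2 w2 /barrier_bend -/q -/g /barrier_steep -/g.
rewrite sE in gE *; rewrite gE.
by field; rewrite gt_eqF.
Qed.

Lemma barrierE d x : 0 < hsq x ->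
  barrier d x = hsq x ^+ 2 + 2 * (d / (2 * Num.sqrt (hsq x))) * hsq x + 16 * x 0 2 ^+ 2.
Proof.
move=> s0; have q0 : 0 < Num.sqrt (hsq x) by rewrite sqrtr_gt0.
have -> : 2 * (d / (2 * Num.sqrt (hsq x))) * hsq x = d * Num.sqrt (hsq x).
  by rewrite -{2}(sqr_sqrtr (hsq_ge0 x)); field; rewrite gt_eqF.
by rewrite /barrier /gauge4; ring.
Qed.

Lemma barrier_steepE d x : 0 < hsq x -> let e := d / (2 * Num.sqrt (hsq x)) in
  barrier_steep d x = 16 * barrier d x - 16 * hsq x * e + 4 * e ^+ 2.
Proof. by move=> s0 e; rewrite barrierE// /barrier_steep /slope -/e; ring. Qed.

Lemma barrier_steep_gt0 d x : 0 < hsq x -> 0 < barrier d x -> 0 < barrier_steep d x.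
Proof.
move=> s0 k0; have DE := barrier_steepE d s0; have gE : barrier_steep d x = _ := erefl.
have : slope d x = 2 * hsq x + d / (2 * Num.sqrt (hsq x)) by [].
rewrite /barrier_steep in gE DE *; move: DE; set e := d / _; set g := slope d x.
move: (hsq x) s0 (barrier d x) k0 (x 0 2) => s s0 K k0 z /= DE ge.
rewrite ltNge; apply/negP => D0.
have /eqP : g ^+ 2 = 0 by have := sqr_ge0 g; have := sqr_ge0 z; lra.
rewrite sqrf_eq0 => /eqP g0; have es : e = - (2 * s) by rewrite g0 in ge; lra.
by rewrite es in DE; have := sqr_ge0 z; nra.
Qed.

(** [ln (barrier d)] is a supersolution for [d <= 0]: in [barrier_bend] the term
    carrying [d] has the sign of [d], and the remaining one is compared by
    [barrier_steep >= 16 * barrier], with equality for [d = 0]. *)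
Lemma barrier_bend_le d x : d <= 0 -> 0 < hsq x -> 0 < barrier d x ->
  barrier_bend d x <= 3 / 4 * hsq x * barrier_steep d x ^+ 2 / barrier d x.
Proof.
move=> d0 s0 k0; have D0 := barrier_steep_gt0 s0 k0; have DE := barrier_steepE d s0.
move: DE; rewrite /barrier_bend; set e := d / _; set K := barrier d x in k0 *.
set D := barrier_steep d x in D0 *; set s := hsq x in s0 * => /= DE.
have e0 : e <= 0 by rewrite mulr_le0_ge0// invr_ge0 mulr_ge0// sqrtr_ge0.
have KD : 16 * K <= D by rewrite DE; nra.
rewrite ler_pdivlMr//.
have g0 := sqr_ge0 (slope d x); move: (slope d x ^+ 2) g0 => g g0.
have : 0 <= - e * g * K by rewrite !mulr_ge0 ?oppr_ge0// ltW.
have : 0 <= s * D * (D - 16 * K).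
  by apply: mulr_ge0; [rewrite mulr_ge0// ltW|rewrite subr_ge0].
lra.
Qed.

(** [ln (barrier d)] is a subsolution for [d >= 0].  Here [barrier_steep] may exceed
    [16 * barrier] near the axis, and the excess is absorbed by the term of
    [barrier_bend] that carries [d]. *)
Lemma barrier_bend_ge d x : 0 <= d -> 0 < hsq x -> 0 < barrier d x ->
  3 / 4 * hsq x * barrier_steep d x ^+ 2 / barrier d x <= barrier_bend d x.
Proof.
move=> d0 s0 k0; rewrite ler_pdivrMr//.
have KE := barrierE d s0; rewrite /barrier_bend /barrier_steep KE /slope.
set e := d / _; set s := hsq x in s0 *; move: (x 0 2) => z.
have e0 : 0 <= e by rewrite divr_ge0// mulr_ge0// sqrtr_ge0.
clear KE; clearbody e s; rewrite -subr_ge0.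
set g := 2 * s + e; have g0 : 0 < g by rewrite ltr_pwDl// mulr_gt0.
(* Both sides agree for e = 0, so e factors out of their difference. *)
rewrite [leRHS](_ : _ = e * (12 * s ^+ 2 * (4 * g ^+ 2 + 256 * z ^+ 2)
   + 8 * g ^+ 2 * (s ^+ 2 + 2 * e * s + 16 * z ^+ 2)
   - 3 * s * e * (4 * g ^+ 2 + 256 * z ^+ 2))); last by rewrite /g; field.
apply: (mulr_ge0 e0).
have -> : 12 * s ^+ 2 * (4 * g ^+ 2 + 256 * z ^+ 2)
    + 8 * g ^+ 2 * (s ^+ 2 + 2 * e * s + 16 * z ^+ 2)
    - 3 * s * e * (4 * g ^+ 2 + 256 * z ^+ 2)
  = 56 * s ^+ 2 * g ^+ 2 + 4 * s * e * g ^+ 2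
    + 128 * z ^+ 2 * (27 * s ^+ 2 + (s - e) ^+ 2) by rewrite /g; ring.
have := ltW s0; move: (sqr_ge0 s) (sqr_ge0 g) (sqr_ge0 z) (sqr_ge0 (s - e)).
move: (s ^+ 2) (g ^+ 2) (z ^+ 2) ((s - e) ^+ 2) => s2 g2 z2 w2 *.
by rewrite !(addr_ge0, mulr_ge0).
Qed.

End PerturbedGauge.

(** * Contact of a flow with a barrier *)
Section Touching.
Context {R : realType}.
Implicit Types (x y v w : heis R) (u : heis R -> R) (d c : R).

Lemma continuous_hsq : continuous (@hsq R).
Proof.
move=> x; rewrite /hsq.
have c0 : (fun y : heis R => y 0 0) @ x --> x 0 0 by exact: coord_continuous.
have c1 : (fun y : heis R => y 0 1) @ x --> x 0 1 by exact: coord_continuous.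
exact: (cvgD (cvgM c0 c0) (cvgM c1 c1)).
Qed.

Lemma continuous_gauge4 : continuous (@gauge4 R).
Proof.
move=> x; rewrite /gauge4; have c := @continuous_hsq x.
have c2 : (fun y : heis R => y 0 2) @ x --> x 0 2 by exact: coord_continuous.
exact: (cvgD (cvgM c c) (cvgM (cvg_cst _) (cvgM c2 c2))).
Qed.

Lemma continuous_barrier d : continuous (@barrier R d).
Proof.
move=> x; rewrite /barrier; have g := @continuous_gauge4 x.
have q : (fun y => Num.sqrt (hsq y)) @ x --> Num.sqrt (hsq x).
  by apply: continuous_comp; [exact: continuous_hsq|exact: sqrt_continuous].
exact: (cvgD g (cvgM (cvg_cst _) q)).
Qed.

Lemma near_gt0 (f : heis R -> R) x : {for x, continuous f} -> 0 < f x ->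
  \forall y \near x, 0 < f y.
Proof. by move=> fc fx; exact: (cvgr_gt _ fc). Qed.

Lemma HIMCF_diff (E0 : set (heis R)) u x : HIMCF_from E0 u -> 0 <= u x ->
  (\forall y \near x, differentiable u y) /\
  (forall v, differentiable ('D_v u) x).
Proof.
move=> [_ [U [Uo HU [du d2u]]] _ _ _] ux; split.
  by apply: filterS (open_nbhs_nbhs (conj Uo (HU _ ux))).
by move=> v; have [+ _] := d2u v; apply; apply: HU.
Qed.

(** The flow equation, read through [hdiv_unit_hgrad]. *)
Lemma HIMCF_characteristic (E0 : set (heis R)) u x : HIMCF_from E0 u ->
  0 <= u x -> 0 < hgrad_norm u x ->
  let W := characteristic_direction u x in
  'D_W ('D_W u) x = hgrad_norm u x ^+ 4.
Proof.
move=> Hu ux n0 /=; have [du d2u] := HIMCF_diff Hu ux.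
have [_ _ _ HM Heq] := Hu.
have ME := (HM _ ux).2.
have xM : (M_ u (u x) `\` Sigma_ u (u x)) x.
  split; first by rewrite ME.
  by rewrite /Sigma_ /= => -[_ /eqP]; rewrite gt_eqF.
have := Heq _ ux x xM; rewrite hdiv_unit_hgrad// => E.
have n3 : hgrad_norm u x ^+ 3 != 0 by rewrite gt_eqF// exprn_gt0.
by rewrite -[LHS](divfK n3) E -exprS.
Qed.

(** At a contact point the gradients are proportional, which fixes the factor
    [r], and [u] is noncharacteristic since the barrier is.  Along the common
    direction [w] both functions have zero derivative, and the second derivative
    of [h] has the sign of [k * (barrier_bend - r * hsq * barrier_steep ^+ 2)].
    The barrier inequality turns its being nonnegative into a comparison of
    [c / barrier d x] with [expR (- (4 / 3) * u x)] that [h x < 0] excludes.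
    The value [k = 1] is contact from one side, [k = - 1] from the other. *)
Lemma no_touching_off_axis (E0 : set (heis R)) u d c k x : HIMCF_from E0 u ->
  let h y := k * (expR (- (4 / 3) * u y) - c / barrier d y) in
  (k = 1 /\ d <= 0) \/ (k = - 1 /\ 0 <= d) ->
  0 <= u x -> 0 < hsq x -> 0 < barrier d x -> 0 < c -> h x < 0 ->
  ~ (\forall y \near x, h x <= h y).
Proof.
move=> Hu h kd ux s0 K0 c0 hneg hmin.
have [du d2u] := HIMCF_diff Hu ux.
have sn : \forall y \near x, 0 < hsq y by apply: near_gt0 => //; exact: continuous_hsq.
have Kn : \forall y \near x, 0 < barrier d y.
  by apply: near_gt0 => //; exact: continuous_barrier.
(* The exponential is made abstract to keep it from being unfolded. *)
have [p pE] : exists p, p = (fun y => expR (- (4 / 3) * u y)) by exact: (ex_intro _ _ erefl).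
have p0 : 0 < p x by rewrite pE expR_gt0.
have hE y : h y = k * (p y - c / barrier d y) by rewrite pE.
have dp y v : differentiable u y -> is_derive y v p (- (4 / 3) * p y * 'D_v u y).
  move=> duy; have e := der_diff v duy; rewrite pE; der.
  by gen_derive; move: (expR _) => *; ring.
pose dh v y := k * (- (4 / 3) * (p y * 'D_v u y) + c * (dbarrier d v y / barrier d y ^+ 2)).
have dhP v : \forall y \near x, is_derive y v h (dh v y).
  near=> y; have sy : 0 < hsq y by near: y.
  have Ky : 0 < barrier d y by near: y.
  have duy : differentiable u y by near: y.
  have ep := dp y v duy; have eK := der_barrier d v sy.
  rewrite (_ : h = fun y => k * (p y - c / barrier d y)); last exact/funext.
  der; first by rewrite gt_eqF.
  rewrite /dh; gen_derive; move: (p y) (barrier d y) (dbarrier d v y) Ky => *.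
  by field; rewrite gt_eqF.
have k2 : k != 0 by case: kd => -[-> _]; rewrite ?oppr_eq0 oner_eq0.
pose r := 3 * c / (4 * p x * barrier d x ^+ 2).
have r0 : 0 < r by rewrite divr_gt0 ?mulr_gt0 ?exprn_gt0.
have uK v : 'D_v u x = r * dbarrier d v x.
  have hx : is_derive x v h (dh v x) := nbhs_singleton (dhP v).
  have /eqP := min_derive_eq0 hx hmin.
  rewrite /dh mulf_eq0 (negPf k2)/= /r; move: ('D_v u x) => D.
  move: (p x) (barrier d x) (dbarrier d v x) p0 K0 => p' K' dK' p0 K0 /eqP E.
  have -> : 3 * c / (4 * p' * K' ^+ 2) * dK' = 3 / (4 * p') * (c * (dK' / K' ^+ 2)).
    by field; rewrite !gt_eqF.
  have -> : c * (dK' / K' ^+ 2) = 4 / 3 * (p' * D) by lra.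
  by field; rewrite gt_eqF.
have g1 : hgrad1 u x = r * barrier1 d x.
  by rewrite /hgrad1 uK -(barrier_grad d s0).1 /hgrad1 (derE (der_barrier _ _ s0)).
have g2 : hgrad2 u x = r * barrier2 d x.
  by rewrite /hgrad2 uK -(barrier_grad d s0).2 /hgrad2 (derE (der_barrier _ _ s0)).
have D0 := barrier_steep_gt0 s0 K0.
have n2 : hgrad_norm u x ^+ 2 = r ^+ 2 * (hsq x * barrier_steep d x).
  by rewrite sqr_sqrtr ?addr_ge0 ?sqr_ge0// g1 g2 -barrier_grad_sq; ring.
have n0 : 0 < hgrad_norm u x.
  have n2p : 0 < r ^+ 2 * (hsq x * barrier_steep d x).
    by apply: mulr_gt0; [exact: exprn_gt0|exact: mulr_gt0].
  rewrite lt_def sqrtr_ge0 andbT; apply: contraTneq n2p => n0.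
  by rewrite -n2 n0 expr0n ltxx.
have := HIMCF_characteristic Hu ux n0; rewrite (_ : _ ^+ 4 = (hgrad_norm u x ^+ 2) ^+ 2); last by ring.
rewrite n2; clear n2 n0.
have [w wE] : exists w, w = characteristic_direction u x by exact: (ex_intro _ _ erefl).
rewrite -wE /= => wwu.
rewrite /characteristic_direction g1 g2 in wE.
have [wK wwK] := der2_barrier s0 wE.
have eu := der_diff w (d2u w).
have ep := dp x w (nbhs_singleton du); have eK := der_barrier d w s0.
have wu : 'D_w u x = 0 by rewrite uK wK mulr0.
have ddh : is_derive x w (dh w) (k * (c / barrier d x ^+ 2 * r ^+ 2 * hsq x
    * (barrier_bend d x - r * hsq x * barrier_steep d x ^+ 2))).
  rewrite /dh; der; first by rewrite gt_eqF ?exprn_gt0.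
  rewrite wu wK wwu /r.
  move: (p x) (barrier d x) p0 K0 (hsq x) (barrier_steep d x) (barrier_bend d x) => p' K' p0 K0 *.
  by field; rewrite !gt_eqF.
have := min_derive2_ge0 (dhP w) ddh hmin.
have q0 : 0 < c / barrier d x ^+ 2 * r ^+ 2 * hsq x.
  apply: mulr_gt0 => //; apply: mulr_gt0; last exact: exprn_gt0.
  by apply: divr_gt0 => //; exact: exprn_gt0.
rewrite mulrCA pmulr_rge0// => {wwK ddh eK ep eu wwu wu}.
have sD0 : 0 < hsq x * barrier_steep d x ^+ 2 by apply: mulr_gt0 => //; exact: exprn_gt0.
have rE : r * (hsq x * barrier_steep d x ^+ 2) =
    (c / barrier d x / p x) * (3 / 4 * hsq x * barrier_steep d x ^+ 2 / barrier d x).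
  by rewrite /r; move: (p x) (barrier d x) p0 K0 => p' K' p0 K0; field; rewrite !gt_eqF.
rewrite -mulrA rE; clear rE.
have T0 : 0 < 3 / 4 * hsq x * barrier_steep d x ^+ 2 / barrier d x.
  by apply: divr_gt0 => //; rewrite -mulrA; apply: mulr_gt0 => //; exact: divr_gt0.
move: hneg; rewrite hE.
have pn0 : p x != 0 by rewrite gt_eqF.
(* q is the ratio of the two functions in contact; T is the value that
   barrier_bend would take if ln K solved the flow equation. *)
have [q qE] : exists q, q = c / barrier d x / p x by exact: (ex_intro _ _ erefl).
have -> : c / barrier d x = q * p x by rewrite qE divfK.
rewrite (mulfK pn0); move: (p x) p0 => p' p1.
have T1 := @barrier_bend_le R d x; have T2 := @barrier_bend_ge R d x.
move: (barrier_bend d x) (_ / barrier d x) T0 T1 T2 => C T T0 T1 T2.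
case: kd => -[-> dsgn] qp.
  have CT := T1 dsgn s0 K0; have q1 : 1 < q by nra.
  by move=> CqT; have := mulr_gt0 T0 (_ : 0 < q - 1); rewrite subr_gt0 => /(_ q1); lra.
have CT := T2 dsgn s0 K0; have q1 : q < 1 by nra.
by move=> CqT; have := mulr_gt0 T0 (_ : 0 < 1 - q); rewrite subr_gt0 => /(_ q1); lra.
Unshelve. all: by end_near. Qed.

End Touching.

(** * The vertical axis, the Koranyi spheres and interior minima *)
Section Comparison.
Context {R : realType}.
Implicit Types (x y v w : heis R) (u : heis R -> R) (d c : R).

(** Summing [h] over opposite horizontal directions cancels the derivative of
    [u] and leaves the corner of the barrier, which decreases [h]. *)
Lemma no_touching_on_axis (E0 : set (heis R)) u d c k x : HIMCF_from E0 u ->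
  let h y := k * (expR (- (4 / 3) * u y) - c / barrier d y) in
  k * d < 0 -> 0 <= u x -> hsq x = 0 -> 0 < barrier d x -> 0 < c ->
  ~ (\forall y \near x, h x <= h y).
Proof.
move=> Hu h kd ux s0 K0 c0 hmin.
have [/nbhs_singleton du _] := HIMCF_diff Hu ux.
have /eqP : x 0 0 ^+ 2 + x 0 1 ^+ 2 = 0 by [].
rewrite paddr_eq0 ?sqr_ge0// !sqrf_eq0 => /andP[/eqP x0 /eqP x1].
have [p pE] : exists p, p = (fun y => expR (- (4 / 3) * u y)) by exact: (ex_intro _ _ erefl).
have dp v : is_derive x v p (- (4 / 3) * p x * 'D_v u x).
  have e := der_diff v du; rewrite pE; der.
  by gen_derive; move: (expR _) => *; ring.
have [v vE] : exists v : heis R, v = vec3 1 0 0 by exact: (ex_intro _ _ erefl).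
have [v' v'E] : exists v' : heis R, v' = - v by exact: (ex_intro _ _ erefl).
have lineE t w : 0 < t -> w = v \/ w = v' ->
    barrier d (t *: w + x) = barrier d x + t ^+ 4 + d * t.
  move=> t0 wv; have sE : hsq (t *: w + x) = t ^+ 2.
    by rewrite /hsq !mxE x0 x1; case: wv => ->; rewrite ?v'E vE !mxE/=; ring.
  have zE : (t *: w + x) 0 2 = x 0 2.
    by rewrite !mxE; case: wv => ->; rewrite ?v'E vE !mxE/=; ring.
  by rewrite /barrier /gauge4 sE zE s0 sqrtr_sqr gtr0_norm// sqrtr0; ring.
have hE y : h y = k * (p y - c / barrier d y) by rewrite pE.
(* For positive t the function e is h (t v + x) + h (- t v + x), and unlike
   this sum it is smooth at t = 0. *)
pose e t := k * (p (t *: v + x) + p (t *: v' + x)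
                 - 2 * c / (barrier d x + t ^+ 4 + d * t)).
have e0 : e 0 = h x + h x.
  by rewrite /e hE !scale0r !add0r expr0n/= mulr0 !addr0; move: (barrier d x)^-1 => *; ring.
have eE t : 0 < t -> e t = h (t *: v + x) + h (t *: v' + x).
  move=> t0; rewrite !hE /e !lineE//; [|by right|by left].
  by move: (_ + d * t)^-1 => *; ring.
have e1 : is_derive (0 : R) (1 : R) e (k * (2 * c * d / barrier d x ^+ 2)).
  have f w : is_derive (0 : R) (1 : R) (fun t : R => p (t *: w + x)) (- (4 / 3) * p x * 'D_w u x).
    by apply: is_derive_line; rewrite scale0r add0r.
  have f1 := f v; have f2 := f v'.
  have i : is_derive (0 : R) (1 : R) (fun t : R => t) (1 : R) := is_derive_id _ _.
  rewrite /e; der; first by rewrite /= expr0n/= mulr0 !addr0 gt_eqF.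
  have -> : 'D_v' u x = - 'D_v u x.
    have bv := derive_basis v du; have bv' := derive_basis v' du.
    rewrite bv bv' v'E vE !mxE/=; gen_derive => *; ring.
  rewrite expr0n/= !mulr0 !addr0; gen_derive.
  by move: (p x) (barrier d x) K0 => *; field; rewrite gt_eqF.
have := right_min_derive_ge0 e1.
have -> : k * (2 * c * d / barrier d x ^+ 2) = (k * d) * (2 * c / barrier d x ^+ 2).
  by move: (barrier d x ^+ 2)^-1 => *; ring.
rewrite pmulr_lge0; last by rewrite divr_gt0 ?exprn_gt0 ?mulr_gt0.
rewrite leNgt kd => H; suff : false by []; apply: H.
have n1 := near_line v hmin; have n2 := near_line v' hmin.
near=> t; have t0 : 0 < t by [].
rewrite e0 eE// lerD//; first by near: t; exact: near_right.
by near: t; exact: near_right.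
Unshelve. all: by end_near. Qed.

Lemma gauge4_ge0 x : 0 <= gauge4 x.
Proof. by rewrite addr_ge0 ?sqr_ge0// mulr_ge0 ?sqr_ge0. Qed.

Lemma koranyi_expr4 x : koranyi x ^+ 4 = gauge4 x.
Proof.
rewrite /koranyi -powR_mulrn ?powR_ge0// -powRrM mul1r mulVf ?pnatr_eq0//.
by rewrite powRr1// gauge4_ge0.
Qed.

Lemma koranyi_ge0 x : 0 <= koranyi x.
Proof. exact: powR_ge0. Qed.

Lemma koranyi_lt1 x : (koranyi x < 1) = (gauge4 x < 1).
Proof. by rewrite -koranyi_expr4 expr_lt1// koranyi_ge0. Qed.

Lemma koranyi_eq_expR x t : (koranyi x = expR (1 / 3 * t)) <-> gauge4 x = expR (4 / 3 * t).
Proof.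
have E : expR (4 / 3 * t) = expR (1 / 3 * t) ^+ 4.
  by rewrite -expRM_natl; congr expR; field.
rewrite -koranyi_expr4 E; split => [->//|/eqP].
by rewrite eqrXn2 ?koranyi_ge0 ?expR_ge0// => /eqP.
Qed.

Lemma norm_le_gauge4 x : `|x| <= gauge4 x + 2.
Proof.
have s2 := sqr_ge0 (hsq x - 1); have := gauge4_ge0 x.
have b (r : R) : `|r| <= r ^+ 2 + 1.
  by have := sqr_ge0 (`|r| - 1); rewrite sqrrB1 real_normK ?num_real//; have := normr_ge0 r; lra.
have b0 := b (x 0 0); have b1 := b (x 0 1); have b2 := b (x 0 2).
have q0 := sqr_ge0 (x 0 0); have q1 := sqr_ge0 (x 0 1); have q2 := sqr_ge0 (x 0 2).
move=> g0; rewrite [leLHS]/Num.norm/= mx_normrE; apply: bigmax_le; first by rewrite addr_ge0.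
move=> [i j] _ /=; rewrite (ord1 i).
have hE : hsq x = x 0 0 ^+ 2 + x 0 1 ^+ 2 by [].
have gE : gauge4 x = hsq x ^+ 2 + 16 * x 0 2 ^+ 2 by [].
have : j \in [:: 0; 1; 2] by case: j => [[|[|[|]]]].
rewrite sqrrB1 in s2.
by rewrite !inE => /or3P[] /eqP ->; lra.
Qed.

(** This serves to approach a Koranyi sphere from the inside; Euclidean
    dilations are not the homogeneous ones, whence an inequality. *)
Lemma gauge4_shrink (t : R) x : 0 <= t <= 1 ->
  gauge4 (t *: - x + x) <= (1 - t) ^+ 2 * gauge4 x.
Proof.
move=> /andP[t0 t1].
have E i : (t *: - x + x) 0 i = (1 - t) * x 0 i by rewrite !mxE; ring.
have -> : gauge4 (t *: - x + x)
    = (1 - t) ^+ 2 * ((1 - t) ^+ 2 * hsq x ^+ 2 + 16 * x 0 2 ^+ 2).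
  by rewrite /gauge4 /hsq !E; ring.
rewrite ler_wpM2l ?sqr_ge0// lerD2r ler_piMl ?sqr_ge0// exprn_ile1 ?subr_ge0//.
by rewrite gerBl.
Qed.

Lemma frontier_gauge4 c : 0 < c ->
  frontier [set x : heis R | gauge4 x < c] = [set x | gauge4 x = c].
Proof.
move=> c0; have cg := @continuous_gauge4 R.
have oE : open [set x : heis R | gauge4 x < c].
  by apply: (@open_comp _ _ gauge4 [set r | r < c]) => //; exact: open_lt.
have cE : closed [set x : heis R | gauge4 x <= c].
  by apply: (@closed_comp _ _ gauge4 [set r | r <= c]) => //; exact: closed_le.
rewrite /frontier (interior_id _).1//; apply/seteqP; split=> x /=.
  move=> [cx /negP]; rewrite -leNgt => xc; apply/eqP; rewrite eq_le xc andbT.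
  suff : closure [set x : heis R | gauge4 x <= c] x by rewrite -(closure_id _).1.
  by apply: closure_subset cx => y /= /ltW.
move=> xc; split; last by rewrite xc ltxx.
move=> B Bx; have n := near_right (near_line (- x) Bx).
near (0 : R)^'+ => t.
have t0 : 0 < t by [].
have t1 : t < 1 by near: t; exact: nbhs_right_lt.
exists (t *: (- x) + x); split; last by near: t.
rewrite /=.
have t01 : 0 <= t <= 1 by rewrite !ltW.
apply: le_lt_trans (gauge4_shrink x t01) _.
by rewrite xc gtr_pMl// exprn_ilt1// ?subr_ge0 ?ltW// gtrBl.
Unshelve. all: by end_near. Qed.

Lemma interior_min (F : heis R -> R) (M m : R) x1 :
  (forall y, 1 <= gauge4 y <= M -> {for y, continuous F}) ->
  (forall y, gauge4 y = 1 -> m <= F y) -> (forall y, gauge4 y = M -> m <= F y) ->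
  1 <= gauge4 x1 <= M -> F x1 < m ->
  exists x0, [/\ 1 < gauge4 x0, F x0 < m & \forall y \near x0, F x0 <= F y].
Proof.
move=> Fc F1 FM x1M Fx1; have cg := @continuous_gauge4 R.
pose A := [set y : heis R | 1 <= gauge4 y <= M].
have cA : compact A.
  apply: bounded_closed_compact.
    exists (M + 2); split; first exact: num_real.
    move=> r Mr y /= /andP[_ yM]; apply: le_trans (norm_le_gauge4 y) _.
    by rewrite (le_trans _ (ltW Mr))// lerD2r.
  have -> : A = [set y | 1 <= gauge4 y] `&` [set y | gauge4 y <= M].
    by apply/seteqP; split => y /= /andP.
  apply: closedI.
    by apply: (@closed_comp _ _ gauge4 [set r | 1 <= r]) => //; exact: closed_ge.
  by apply: (@closed_comp _ _ gauge4 [set r | r <= M]) => //; exact: closed_le.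
have [|x0] := @EVT_min_rV R 3 F A (ex_intro _ x1 x1M) cA.
  apply: continuous_in_subspaceT => y; rewrite inE; exact: Fc.
rewrite inE => /= /andP[x0ge x0le] Fmin.
have Fx0 : F x0 < m by apply: le_lt_trans Fx1; apply: Fmin; rewrite inE.
have x0gt : 1 < gauge4 x0.
  rewrite lt_def x0ge andbT; apply: contraTneq Fx0 => /F1; by rewrite leNgt.
have x0lt : gauge4 x0 < M.
  rewrite lt_def x0le andbT eq_sym; apply: contraTneq Fx0 => /FM; by rewrite leNgt.
exists x0; split => //.
near=> y; apply: Fmin; rewrite inE /A/=; apply/andP; split; apply: ltW; near: y.
  exact: (cvgr_gt _ (cg x0)).
exact: (cvgr_lt _ (cg x0)).
Unshelve. all: by end_near. Qed.

End Comparison.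

(** * Uniqueness of the flow *)
Section Uniqueness.
Context {R : realType}.
Implicit Types (x y v w : heis R) (u : heis R -> R) (d c : R).

Lemma no_touching (E0 : set (heis R)) u d c k x : HIMCF_from E0 u ->
  let h y := k * (expR (- (4 / 3) * u y) - c / barrier d y) in
  (k = 1 /\ d < 0) \/ (k = - 1 /\ 0 < d) ->
  0 <= u x -> 0 < barrier d x -> 0 < c -> h x < 0 ->
  ~ (\forall y \near x, h x <= h y).
Proof.
move=> Hu h kd ux K0 c0 hneg; have [s0|s0] := eqVneq (hsq x) 0.
  by apply: no_touching_on_axis Hu _ _ _ _ _ => //; case: kd => -[-> ?]; lra.
apply: no_touching_off_axis Hu _ _ _ _ _ _ => //.
  by case: kd => -[-> /ltW ?]; [left|right].
by rewrite lt_def s0 hsq_ge0.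
Qed.

Lemma sqrt_hsq_le x : 1 <= gauge4 x -> Num.sqrt (hsq x) <= gauge4 x.
Proof.
move=> N1; have N0 : 0 <= gauge4 x by rewrite (le_trans _ N1).
rewrite -(ger0_norm N0) -sqrtr_sqr ler_wsqrtr//.
have : hsq x ^+ 2 <= gauge4 x by rewrite lerDl mulr_ge0 ?sqr_ge0.
have := sqr_ge0 (hsq x - 1); rewrite sqrrB1.
have : gauge4 x <= gauge4 x ^+ 2 by rewrite -[leLHS]mul1r expr2 ler_wpM2r.
by move: (gauge4 x ^+ 2) (hsq x ^+ 2) => *; lra.
Qed.

Lemma gauge4_le_norm x (B : R) : `|x| <= B -> gauge4 x <= 4 * B ^+ 4 + 16 * B ^+ 2.
Proof.
move=> xB.
have H i : x 0 i ^+ 2 <= B ^+ 2.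
  have xi : `|x 0 i| <= B.
    apply: le_trans xB; rewrite [leRHS]/Num.norm/= mx_normrE.
    by apply: (le_trans _ (le_bigmax _ _ (0, i))).
  by rewrite -real_normK ?num_real// lerXn2r ?nnegrE// (le_trans _ xi).
have h0 := H 0; have h1 := H 1; have h2 := H 2.
have hE : hsq x = x 0 0 ^+ 2 + x 0 1 ^+ 2 by [].
have -> : 4 * B ^+ 4 = (2 * B ^+ 2) ^+ 2 by ring.
have h : hsq x <= 2 * B ^+ 2 by rewrite hE; lra.
apply: lerD; last by rewrite ler_pM2l.
by rewrite lerXn2r ?nnegrE ?hsq_ge0// (le_trans (hsq_ge0 x) h).
Qed.

Lemma continuousV_at (T : topologicalType) (f : T -> R) (a : T) : f a != 0 ->
  {for a, continuous f} -> {for a, continuous (fun z => (f z)^-1)}.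
Proof. by move=> fa fc; apply: cvgV. Qed.

Let E0 : set (heis R) := [set x | koranyi x < 1].

Lemma HIMCF_lt0 u x : HIMCF_from E0 u -> (u x < 0) = (gauge4 x < 1).
Proof.
move=> [E _ _ _ _]; rewrite -koranyi_lt1.
have EE : E_ u 0 x <-> E0 x by rewrite E.
by apply/idP/idP => H; [exact: EE.1|exact: EE.2].
Qed.

Lemma HIMCF_ge0 u x : HIMCF_from E0 u -> (0 <= u x) = (1 <= gauge4 x).
Proof. by move=> Hu; rewrite !leNgt (HIMCF_lt0 _ Hu). Qed.

Lemma HIMCF_sphere u x : HIMCF_from E0 u -> gauge4 x = 1 -> u x = 0.
Proof.
move=> Hu x1; have [E _ _ HM _] := Hu.
have [_ M0] := HM 0 (lexx _).
have : M_ u 0 x.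
  rewrite /M_ E /E0 (_ : [set x | _] = [set x | gauge4 x < 1]).
    by rewrite frontier_gauge4.
  by apply/seteqP; split => y /=; rewrite koranyi_lt1.
by rewrite M0.
Qed.

Lemma HIMCF_continuous u x : HIMCF_from E0 u -> 1 <= gauge4 x ->
  {for x, continuous (fun y => expR (- (4 / 3) * u y))}.
Proof.
move=> Hu; rewrite -(HIMCF_ge0 _ Hu) => ux.
have [/nbhs_singleton/differentiable_continuous cu _] := HIMCF_diff Hu ux.
apply: (@continuous_comp _ _ _ (fun y => - (4 / 3) * u y) expR).
  exact: (cvgM (cvg_cst _) cu).
exact: continuous_expR.
Qed.

(** On the region [1 <= gauge4 <= M] the function [F = K (e + p)] is at least
    [1 - b] on both boundary spheres: for [gauge4 = 1] because [p = 1], for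
    [gauge4 = M] because of [e].  The constants [b] and [e] are so small that
    the value at [x] is less than [1 - b]. *)
Lemma HIMCF_lower u x : HIMCF_from E0 u -> 1 <= gauge4 x ->
  1 <= gauge4 x * expR (- (4 / 3) * u x).
Proof.
move=> Hu x1; rewrite leNgt; apply/negP => th1.
have [p pE] : exists p, p = (fun y => expR (- (4 / 3) * u y)) by exact: (ex_intro _ _ erefl).
have p0 y : 0 < p y by rewrite pE expR_gt0.
have pc y : 1 <= gauge4 y -> {for y, continuous p} by rewrite pE; exact: HIMCF_continuous.
have ppE y : expR (- (4 / 3) * u y) = p y by rewrite pE.
have N0 : 0 < gauge4 x by rewrite (lt_le_trans _ x1).
move: th1; rewrite ppE; set th := _ * p x => th1.
have th0 : 0 < th by rewrite mulr_gt0.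
pose b := (1 - th) / 2; pose e := (1 - th) / (4 * gauge4 x).
have b0 : 0 < b by rewrite divr_gt0// subr_gt0.
have b1 : b < 1 by rewrite /b; lra.
have e0 : 0 < e by rewrite divr_gt0 ?subr_gt0// mulr_gt0.
have Kle y : 1 <= gauge4 y -> (1 - b) * gauge4 y <= barrier (- b) y.
  by move=> /sqrt_hsq_le h; rewrite /barrier mulrBl mul1r mulNr lerB// ler_pM2l.
have K0 y : 1 <= gauge4 y -> 0 < barrier (- b) y.
  move=> y1; apply: lt_le_trans (Kle y y1).
  by rewrite mulr_gt0 ?subr_gt0// (lt_le_trans _ y1).
pose F y := barrier (- b) y * (e + p y).
pose M := Num.max (gauge4 x) e^-1.
have [|||||x0 [x0gt Fx0 Fmin]] := @interior_min R F M (1 - b) x.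
- move=> y /andP[y1 _].
  exact: (cvgM (@continuous_barrier R (- b) y) (cvgD (cvg_cst _) (pc y y1))).
- move=> y y1; have u0 := HIMCF_sphere Hu y1.
  have := Kle y; rewrite y1 mulr1 => /(_ (lexx _)) h; apply: le_trans h _.
  have Ky : 0 <= barrier (- b) y by rewrite ltW// K0 ?y1.
  by rewrite ler_peMr// -ppE u0 mulr0 expR0 lerDr ltW.
- move=> y yM; have y1 : 1 <= gauge4 y by rewrite yM le_max x1.
  have h := Kle y y1.
  have : 1 <= gauge4 y * e by rewrite yM -ler_pdivrMr// div1r le_max lexx orbT.
  move=> ye; apply: (@le_trans _ _ ((1 - b) * gauge4 y * e)).
    by rewrite -mulrA ler_peMr// subr_ge0 ltW.
  apply: (@le_trans _ _ (barrier (- b) y * e)); first by rewrite ler_pM2r.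
  by rewrite ler_pM2l ?K0// lerDl ltW.
- by rewrite x1 le_max lexx.
- rewrite /F; apply: (@le_lt_trans _ _ (gauge4 x * (e + p x))).
    rewrite ler_wpM2r//; first by rewrite ltW// addr_gt0.
    rewrite /barrier gerDl mulNr oppr_le0.
    by rewrite mulr_ge0 ?sqrtr_ge0// ltW.
  rewrite mulrDr -/th (_ : _ * e = (1 - th) / 4).
    by rewrite /b; lra.
  by rewrite /e; field; rewrite gt_eqF.
have Kx0 := K0 _ (ltW x0gt).
have c0 : 0 < F x0 by apply: mulr_gt0 => //; exact: addr_gt0.
pose h y := 1 * (expR (- (4 / 3) * u y) - F x0 / barrier (- b) y).
have hx0 : h x0 = - e.
  rewrite /h ppE /F; move: (barrier (- b) x0) (p x0) Kx0 => *.
  by field; rewrite gt_eqF.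
apply: (no_touching (d := - b) (c := F x0) (k := 1) (x := x0) Hu) => //.
- by left; rewrite oppr_lt0.
- by rewrite (HIMCF_ge0 _ Hu) ltW.
- by rewrite -/(h x0) hx0 oppr_lt0.
rewrite -/(h x0) hx0.
have Kn : \forall y \near x0, 0 < barrier (- b) y.
  by apply: near_gt0 => //; exact: continuous_barrier.
near=> y; have Ky : 0 < barrier (- b) y by near: y.
have Fy : F x0 <= F y by near: y.
have : F x0 / barrier (- b) y <= e + p y by rewrite ler_pdivrMr// mulrC.
by rewrite mul1r ppE; lra.
Unshelve. all: by end_near. Qed.

(** The same argument with [F = (e + 1 / K) / p].  The outer sphere now lies
    outside the bounded set where [u < 1 / e], so that [p <= e] there. *)
Lemma HIMCF_upper u x : HIMCF_from E0 u -> 1 <= gauge4 x ->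
  gauge4 x * expR (- (4 / 3) * u x) <= 1.
Proof.
move=> Hu x1; rewrite leNgt; apply/negP => th1.
have [p pE] : exists p, p = (fun y => expR (- (4 / 3) * u y)) by exact: (ex_intro _ _ erefl).
have p0 y : 0 < p y by rewrite pE expR_gt0.
have pc y : 1 <= gauge4 y -> {for y, continuous p} by rewrite pE; exact: HIMCF_continuous.
have ppE y : expR (- (4 / 3) * u y) = p y by rewrite pE.
have N0 : 0 < gauge4 x by rewrite (lt_le_trans _ x1).
move: th1; rewrite ppE => th1.
pose th := (gauge4 x * p x)^-1.
have th0 : 0 < th by rewrite invr_gt0 mulr_gt0.
have {}th1 : th < 1 by rewrite invf_lt1// (lt_trans _ th1).
pose b := (1 - th) / 2; pose e := (1 - th) * p x / 4.
have b0 : 0 < b by rewrite divr_gt0// subr_gt0.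
have b1 : b < 1 by rewrite /b; lra.
have e0 : 0 < e by rewrite divr_gt0 ?mulr_gt0 ?subr_gt0.
have Kge y : gauge4 y <= barrier b y by rewrite lerDl mulr_ge0 ?sqrtr_ge0// ltW.
have K0 y : 1 <= gauge4 y -> 0 < barrier b y.
  by move=> y1; rewrite (lt_le_trans _ (Kge y))// (lt_le_trans _ y1).
pose F y := (e + (barrier b y)^-1) / p y.
have Ti0 : 0 <= e^-1 by rewrite invr_ge0 ltW.
have [_ _ _ HM _] := Hu; have [[B [_ HB]] _] := HM _ Ti0.
pose B' := 4 * (B + 1) ^+ 4 + 16 * (B + 1) ^+ 2 + 1.
pose M := Num.max (gauge4 x) B'.
have [|||||x0 [x0gt Fx0 Fmin]] := @interior_min R F M (1 - b) x.
- move=> y /andP[y1 _]; have py : p y != 0 by rewrite gt_eqF.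
  have Ky : barrier b y != 0 by rewrite gt_eqF ?K0.
  have iK := continuousV_at Ky (@continuous_barrier R b y).
  have ip := continuousV_at py (pc y y1).
  exact: (cvgM (cvgD (cvg_cst _) iK) ip).
- move=> y y1; have u0 := HIMCF_sphere Hu y1.
  rewrite /F -ppE u0 mulr0 expR0 divr1.
  have N1 : 1 <= gauge4 y by rewrite y1.
  have h : barrier b y <= 1 + b.
    by rewrite /barrier y1 lerD2l -[leRHS]mulr1 ler_pM2l// -[leRHS]y1 sqrt_hsq_le.
  apply: (@le_trans _ _ (1 + b)^-1).
    by rewrite -[leRHS]div1r ler_pdivlMr ?addr_gt0//; have := sqr_ge0 b; lra.
  apply: (@le_trans _ _ (barrier b y)^-1); last by rewrite lerDr ltW.
  by rewrite lef_pV2 ?posrE ?K0// addr_gt0.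
- move=> y yM; have y1 : 1 <= gauge4 y by rewrite yM le_max x1.
  have uy : e^-1 <= u y.
    rewrite leNgt; apply/negP => uy.
    have := HB (B + 1) (_ : B < B + 1) y uy; rewrite ltrDl ltr01 => /(_ erefl).
    move=> /gauge4_le_norm; rewrite yM leNgt => /negP; apply.
    by rewrite lt_max /B' ltrDl ltr01 orbT.
  have pe : p y <= e.
    rewrite -ppE mulNr expRN -[leRHS]invrK lef_pV2 ?posrE ?invr_gt0 ?expR_gt0//.
    apply: le_trans (expR_ge1Dx _); lra.
  apply: (@le_trans _ _ 1); first by rewrite gerBl ltW.
  by rewrite /F ler_pdivlMr// mul1r (le_trans pe)// lerDl invr_ge0 ltW ?K0.
- by rewrite x1 le_max lexx.
- rewrite /F; apply: (@le_lt_trans _ _ ((e + (gauge4 x)^-1) / p x)).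
    by rewrite ler_pM2r ?invr_gt0// lerD2l lef_pV2 ?posrE ?K0.
  rewrite (_ : _ / p x = (1 - th) / 4 + th); first by rewrite /b; lra.
  by rewrite /e /th; move: (p x) (p0 x) => q q0; field; rewrite !gt_eqF.
have Kx0 := K0 _ (ltW x0gt).
have Ki0 : 0 < (barrier b x0)^-1 by rewrite invr_gt0.
have c0 : 0 < F x0 by apply: divr_gt0 => //; exact: addr_gt0.
pose h y := -1 * (expR (- (4 / 3) * u y) - (F x0)^-1 / barrier b y).
have hx0 : h x0 = - (e / F x0).
  rewrite /h ppE.
  have -> : p x0 = (e + (barrier b x0)^-1) / F x0.
    by rewrite /F invf_div mulrCA divff ?mulr1// gt_eqF// addr_gt0.
  by move: (F x0)^-1 (barrier b x0)^-1 => *; ring.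
apply: (no_touching (d := b) (c := (F x0)^-1) (k := -1) (x := x0) Hu) => //.
- by right.
- by rewrite (HIMCF_ge0 _ Hu) ltW.
- by rewrite invr_gt0.
- by rewrite -/(h x0) hx0 oppr_lt0 divr_gt0.
rewrite -/(h x0) hx0.
have Kn : \forall y \near x0, 0 < barrier b y.
  by apply: near_gt0 => //; exact: continuous_barrier.
near=> y; have Ky : 0 < barrier b y by near: y.
have : F x0 <= F y by near: y.
rewrite {2}/F ler_pdivlMr// ppE -ler_pdivlMl// => Fy.
have : p y <= (F x0)^-1 * e + (F x0)^-1 * (barrier b y)^-1 by rewrite -mulrDr.
lra.
Unshelve. all: by end_near. Qed.

Lemma HIMCF_eq u x : HIMCF_from E0 u -> 0 <= u x -> gauge4 x = expR (4 / 3 * u x).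
Proof.
move=> Hu; rewrite (HIMCF_ge0 _ Hu) => x1.
have H : gauge4 x * expR (- (4 / 3) * u x) = 1.
  by apply/eqP; rewrite eq_le HIMCF_upper// HIMCF_lower.
have e0 : expR (4 / 3 * u x) != 0 by rewrite gt_eqF// expR_gt0.
by rewrite mulNr expRN in H; rewrite -[LHS](divfK e0) H mul1r.
Qed.

Lemma HIMCF_level u t : HIMCF_from E0 u -> 0 <= t ->
  M_ u t = [set x | koranyi x = expR (1 / 3 * t)].
Proof.
move=> Hu t0; have [_ _ _ HM _] := Hu; rewrite (HM t t0).2.
apply/seteqP; split => x /= => [ut|/koranyi_eq_expR N].
  by apply/koranyi_eq_expR; rewrite -ut; apply: HIMCF_eq => //; rewrite ut.
have ux : 0 <= u x.
  by rewrite (HIMCF_ge0 _ Hu) N -expR0 ler_expR mulr_ge0.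
have := HIMCF_eq Hu ux; rewrite N => /expR_inj; lra.
Qed.

End Uniqueness.

(** * Functions of class C^k on an open set *)
Section SmoothFunctions.
Context {R : realType} {V : normedModType R}.
Implicit Types (f g : V -> R) (U : set V).

Lemma differentiable_near_eq f g (x : V) : (\forall y \near x, f y = g y) ->
  differentiable f x -> differentiable g x.
Proof.
move=> fg df; have [dfc fE] := (diff_locallyP x f).1 df.
have gE : g \o shift x = cst (g x) + 'd f x +o_ (0 : V) id.
  apply/eqaddoP => _/posnumP[e].
  have /eqaddoP/(_ e%:num) /(_ [gt0 of e%:num]) := fE.
  have fgx : f x = g x := nbhs_singleton fg.
  have sc : (fun h : V => h + x) @ (0 : V) --> x.
    by rewrite -[X in _ --> X]add0r; apply: cvgD; [exact: cvg_id|exact: cvg_cst].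
  have := sc _ fg; rewrite nbhs_simpl/= => fgs; apply: filterS2 fgs => h /= fgh.
  by rewrite /= !fctE /= fgh fgx.
have gd : 'd g x = 'd f x :> (V -> R) by exact: diff_unique.
by apply/diff_locallyP; rewrite gd.
Qed.

(** Induction on [k] in the lemmas below replaces a derivative by a formula that
    agrees with it on [U] only. *)
Lemma Ck_on_eq k U f g : open U -> (forall x, U x -> f x = g x) ->
  Ck_on k U f -> Ck_on k U g.
Proof.
move=> Uo; elim: k f g => [|k IH] f g fg.
  move=> fc x Ux; rewrite /prop_for /continuous_at -fg//.
  apply: cvg_trans (fc x Ux); apply: near_eq_cvg.
  by apply: filterS (open_nbhs_nbhs (conj Uo Ux)).
have fgn x : U x -> \forall y \near x, f y = g y.
  by move=> Ux; apply: filterS (open_nbhs_nbhs (conj Uo Ux)).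
move=> [df Df]; split=> [x Ux|v].
  exact: (differentiable_near_eq (fgn x Ux) (df x Ux)).
apply: IH (Df v) => x Ux; exact: near_eq_derive (fgn x Ux).
Qed.

Lemma Ck_onW k U f : Ck_on k.+1 U f -> Ck_on k U f.
Proof.
elim: k f => [|k IH] f [df Df].
  by move=> x Ux; exact: differentiable_continuous (df x Ux).
by split=> // v; apply: IH (Df v).
Qed.

Lemma Ck_on_cst k U (a : R) : Ck_on k U (fun=> a).
Proof.
elim: k a => [|k IH] a; first by move=> x _; exact: cvg_cst.
split=> [x _|v]; first exact: differentiable_cst.
rewrite (_ : 'D_v _ = fun=> 0); first exact: IH.
by apply/funext => x; rewrite (derE (der_cst a x v)).
Qed.

Lemma Ck_on_add k U f g : open U -> Ck_on k U f -> Ck_on k U g ->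
  Ck_on k U (fun x => f x + g x).
Proof.
move=> Uo; elim: k f g => [|k IH] f g.
  by move=> fc gc x Ux; exact: (cvgD (fc x Ux) (gc x Ux)).
move=> [df Df] [dg Dg]; split=> [x Ux|v].
  exact: (differentiableD (df x Ux) (dg x Ux)).
apply: Ck_on_eq (IH _ _ (Df v) (Dg v)) => // x Ux.
by rewrite (derE (der_add (der_diff v (df x Ux)) (der_diff v (dg x Ux)))).
Qed.

Lemma Ck_on_mul k U f g : open U -> Ck_on k U f -> Ck_on k U g ->
  Ck_on k U (fun x => f x * g x).
Proof.
move=> Uo; elim: k f g => [|k IH] f g.
  by move=> fc gc x Ux; exact: (cvgM (fc x Ux) (gc x Ux)).
move=> Cf Cg; have [df Df] := Cf; have [dg Dg] := Cg; split=> [x Ux|v].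
  exact: (differentiableM (df x Ux) (dg x Ux)).
apply: Ck_on_eq (Ck_on_add Uo (IH _ _ (Df v) (Ck_onW Cg))
  (IH _ _ (Ck_onW Cf) (Dg v))) => // x Ux.
by rewrite (derE (der_mul (der_diff v (df x Ux)) (der_diff v (dg x Ux)))).
Qed.

Lemma Ck_on_inv k U f : open U -> (forall x, U x -> f x != 0) -> Ck_on k U f ->
  Ck_on k U (fun x => (f x)^-1).
Proof.
move=> Uo f0; elim: k => [|k IH].
  by move=> fc x Ux; exact: continuousV_at (f0 x Ux) (fc x Ux).
move=> Cf; have [df Df] := Cf; split=> [x Ux|v].
  exact: differentiableV (df x Ux) (f0 x Ux).
have CV := IH (Ck_onW Cf).
apply: (Ck_on_eq (f := fun x => (-1 * 'D_v f x) * ((f x)^-1 * (f x)^-1))) => //.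
  move=> x Ux; rewrite (derE (der_inv (f0 x Ux) (der_diff v (df x Ux)))).
  by rewrite expr2 invfM mulN1r.
exact: (Ck_on_mul Uo (Ck_on_mul Uo (Ck_on_cst _ _ _) (Df v)) (Ck_on_mul Uo CV CV)).
Qed.

Lemma Ck_on_ln k U f : open U -> (forall x, U x -> 0 < f x) -> Ck_on k.+1 U f ->
  Ck_on k.+1 U (fun x => ln (f x)).
Proof.
move=> Uo f0 Cf; have [df Df] := Cf; split=> [x Ux|v].
  apply: (@differentiable_comp _ _ _ _ f (@ln R)); first exact: df.
  by apply/derivable1_diffP; apply: ex_derive; apply: is_derive1_ln; exact: f0.
apply: (Ck_on_eq (f := fun x => (f x)^-1 * 'D_v f x)) => //.
  move=> x Ux.
  by rewrite (derE (der_comp (is_derive1_ln (f0 x Ux)) (der_diff v (df x Ux)))).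
have fn0 x : U x -> f x != 0 by move=> Ux; rewrite gt_eqF ?f0.
exact: (Ck_on_mul Uo (Ck_on_inv Uo fn0 (Ck_onW Cf)) (Df v)).
Qed.

End SmoothFunctions.

(** * The flow of Koranyi spheres *)
Section KoranyiFlow.
Context {R : realType}.
Implicit Types (x y v w : heis R) (U : set (heis R)).

Lemma Ck_on_coord k U (i : 'I_3) : Ck_on k U (fun x => x 0 i).
Proof.
case: k => [|k]; first by move=> x _; exact: coord_continuous.
split=> [x _|v]; first exact: differentiable_coord.
rewrite (_ : 'D_v _ = fun=> v 0 i); first exact: Ck_on_cst.
by apply/funext => x; rewrite (derE (der_coord x v i)).
Qed.

Lemma Ck_on_gauge4 k U : open U -> Ck_on k U (@gauge4 R).
Proof.
move=> Uo.
have sq f : Ck_on k U f -> Ck_on k U (fun x => f x ^+ 2) by move=> Cf; exact: (Ck_on_mul Uo Cf Cf).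
have c i := @Ck_on_coord k U i.
have Ch := Ck_on_add Uo (sq _ (c 0)) (sq _ (c 1)).
exact: (Ck_on_add Uo (sq _ Ch) (Ck_on_mul Uo (Ck_on_cst _ _ _) (sq _ (c 2)))).
Qed.

(** As [ln 0 = 0], the value at the centre of the ball is set apart, to be
    negative. *)
Definition koranyi_time x : R :=
  if gauge4 x == 0 then -1 else 3 / 4 * ln (gauge4 x).

Lemma koranyi_timeE x : 0 < gauge4 x -> koranyi_time x = 3 / 4 * ln (gauge4 x).
Proof. by move=> x0; rewrite /koranyi_time gt_eqF. Qed.

Lemma koranyi_time_lt x (t : R) : 0 <= t -> (koranyi_time x < t) = (gauge4 x < expR (4 / 3 * t)).
Proof.
move=> t0; rewrite /koranyi_time; case: eqVneq => [->|x0].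
  by rewrite expR_gt0 (lt_le_trans _ t0)// ltrN10.
have xp : 0 < gauge4 x by rewrite lt_def x0 gauge4_ge0.
rewrite -{2}(lnK xp) ltr_expR.
by apply/idP/idP => H; lra.
Qed.

Lemma koranyi_time_le x (t : R) : 0 <= t ->
  (t <= koranyi_time x) = (expR (4 / 3 * t) <= gauge4 x).
Proof. by move=> t0; rewrite !leNgt koranyi_time_lt. Qed.

Lemma koranyi_time_eq x (t : R) : 0 <= t ->
  (koranyi_time x = t) <-> (gauge4 x = expR (4 / 3 * t)).
Proof.
move=> t0; split=> [tE|NE].
  have x0 : 0 < gauge4 x.
    rewrite (lt_le_trans (expR_gt0 (4 / 3 * t)))// -koranyi_time_le// tE//.
  by rewrite -tE koranyi_timeE// mulrA -[LHS](lnK x0); congr expR; field.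
by rewrite koranyi_timeE NE ?expR_gt0// expRK; field.
Qed.

(** The flow equation is the case [d = 0] of the computations on barriers, with
    [r = 3 / (4 * gauge4 x)]: both [barrier_bend] and [barrier_steep] are then
    multiples of [gauge4 x]. *)
Lemma koranyi_flow : HIMCF_from [set x : heis R | koranyi x < 1] koranyi_time.
Proof.
pose U := [set x : heis R | 0 < gauge4 x].
have Uo : open U.
  apply: (@open_comp _ _ (@gauge4 R) [set r | 0 < r]); last exact: open_gt.
  by move=> x _; exact: continuous_gauge4.
have U0 x : 0 <= koranyi_time x -> U x.
  by rewrite koranyi_time_le// mulr0 expR0 => x1; rewrite /U/= (lt_le_trans _ x1).
have du x v : U x -> is_derive x v koranyi_time
    (3 / 4 * (2 * hsq x * (2 * (x 0 0 * v 0 0 + x 0 1 * v 0 1)) + 32 * x 0 2 * v 0 2) / gauge4 x).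
  move=> Ux; apply: (@near_eq_is_derive _ _ _ (fun y => 3 / 4 * ln (gauge4 y))).
    by apply: filterS (open_nbhs_nbhs (conj Uo Ux)) => y Uy; rewrite koranyi_timeE.
  have e := der_gauge4 x v; der => //.
  by move: (gauge4 x)^-1 => *; ring.
have Ck : Ck_on 2 U koranyi_time.
  apply: (Ck_on_eq (f := fun y => 3 / 4 * ln (gauge4 y))) => //.
    by move=> x Ux; rewrite koranyi_timeE.
  exact: (Ck_on_mul Uo (Ck_on_cst _ _ _) (Ck_on_ln Uo (fun _ => id) (Ck_on_gauge4 2 Uo))).
have HM t : 0 <= t -> bounded_set (E_ koranyi_time t) /\
    M_ koranyi_time t = [set x | koranyi_time x = t].
  move=> t0; split.
    exists (expR (4 / 3 * t) + 2); split; first exact: num_real.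
    move=> r tr y; rewrite /E_ /= koranyi_time_lt// => yt.
    apply: le_trans (norm_le_gauge4 y) _.
    by rewrite (le_trans _ (ltW tr))// lerD2r ltW.
  rewrite /M_ (_ : E_ _ _ = [set x | gauge4 x < expR (4 / 3 * t)]).
    rewrite frontier_gauge4 ?expR_gt0//.
    by apply/seteqP; split => x /koranyi_time_eq; apply.
  by apply/seteqP; split => x; rewrite /E_ /= koranyi_time_lt.
split => //.
- apply/seteqP; split => x; rewrite /E_ /= koranyi_lt1 koranyi_time_lt// mulr0 expR0//.
- by exists U; split => //; exact: U0.
- move=> x /U0 Ux; exists (vec3 (x 0 0) (x 0 1) (x 0 2)).
  rewrite (derE (du _ _ Ux)) !(vec3E _ _ _).1 !(vec3E _ _ _).2.1 !(vec3E _ _ _).2.2.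
  rewrite gt_eqF// divr_gt0// mulr_gt0//.
  have : 0 < hsq x ^+ 2 + 16 * x 0 2 ^+ 2 by [].
  have -> : 2 * hsq x * (2 * (x 0 0 * x 0 0 + x 0 1 * x 0 1)) = 4 * hsq x ^+ 2.
    by rewrite /hsq; ring.
  by have := sqr_ge0 (hsq x); have := sqr_ge0 (x 0 2); rewrite -mulrA -expr2; lra.
move=> t t0 x [Mx nS].
have xt : koranyi_time x = t by move: Mx; rewrite (HM t t0).2.
have Ux : U x by apply: U0; rewrite xt.
have n0 : 0 < hgrad_norm koranyi_time x.
  by rewrite lt_def sqrtr_ge0 andbT; apply/eqP => n0; apply: nS.
have [dk Dk] := Ck.
have dkx : \forall y \near x, differentiable koranyi_time y.
  by apply: filterS (open_nbhs_nbhs (conj Uo Ux)).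
have d2k v : differentiable ('D_v koranyi_time) x by have [+ _] := Dk v; exact.
rewrite hdiv_unit_hgrad//; set w := characteristic_direction _ _.
have NE y : barrier 0 y = gauge4 y by rewrite /barrier mul0r addr0.
have dE y v : U y -> 'D_v koranyi_time y = 3 / (4 * gauge4 y) * dbarrier 0 v y.
  move=> Uy; rewrite (derE (du y v Uy)) /dbarrier /slope mul0r addr0.
  by have := Uy; rewrite /U/=; move: (hsq y) (gauge4 y) => s N N0; field; rewrite gt_eqF.
have s0 : 0 < hsq x.
  rewrite lt_def hsq_ge0 andbT; apply: contraTneq n0 => s0; rewrite -leNgt.
  have /eqP : x 0 0 ^+ 2 + x 0 1 ^+ 2 = 0 by [].
  rewrite paddr_eq0 ?sqr_ge0// !sqrf_eq0 => /andP[/eqP x0 /eqP x1].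
  have h1 : hgrad1 koranyi_time x = 0.
    by rewrite /hgrad1 dE// /dbarrier !mxE/= x0 x1; ring.
  have h2 : hgrad2 koranyi_time x = 0.
    by rewrite /hgrad2 dE// /dbarrier !mxE/= x0 x1; ring.
  by rewrite /hgrad_norm h1 h2 expr0n/= addr0 sqrtr0.
pose r := 3 / (4 * gauge4 x).
have g1 : hgrad1 koranyi_time x = r * barrier1 0 x.
  by rewrite /hgrad1 dE// -(barrier_grad 0 s0).1 /hgrad1 (derE (der_barrier _ _ s0)).
have g2 : hgrad2 koranyi_time x = r * barrier2 0 x.
  by rewrite /hgrad2 dE// -(barrier_grad 0 s0).2 /hgrad2 (derE (der_barrier _ _ s0)).
have DE : barrier_steep 0 x = 16 * gauge4 x.
  by rewrite /barrier_steep /slope mul0r addr0 /gauge4; ring.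
have n2 : hgrad_norm koranyi_time x ^+ 2 = r ^+ 2 * (hsq x * (16 * gauge4 x)).
  by rewrite sqr_sqrtr ?addr_ge0 ?sqr_ge0// g1 g2 -DE -barrier_grad_sq; ring.
have wE : w = - (r * barrier2 0 x) *: X1 x + (r * barrier1 0 x) *: X2 x.
  by rewrite /w /characteristic_direction g1 g2.
clearbody w; have [wK wwK] := der2_barrier s0 wE.
have dw : is_derive x w ('D_w koranyi_time) (hgrad_norm koranyi_time x ^+ 4).
  apply: (@near_eq_is_derive _ _ _ (fun y => 3 / 4 * (dbarrier 0 w y / gauge4 y))).
    apply: filterS (open_nbhs_nbhs (conj Uo Ux)) => y Uy; rewrite dE//.
    by have := Uy; rewrite /U/=; move: (gauge4 y) (dbarrier 0 w y) => N D N0; field; rewrite gt_eqF.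
  have e := der_gauge4 x w; der; first by rewrite gt_eqF.
  rewrite (_ : _ ^+ 4 = (hgrad_norm koranyi_time x ^+ 2) ^+ 2); last by ring.
  rewrite n2 wK /barrier_bend DE /slope !mul0r mulr0 mul0r !addr0 /r.
  by have := Ux; rewrite /U/=; move: (gauge4 x) (hsq x) => N s N0; field; rewrite gt_eqF.
have n3 : hgrad_norm koranyi_time x ^+ 3 != 0 by rewrite gt_eqF// exprn_gt0.
by rewrite (derE dw) exprS mulfK.
Qed.

End KoranyiFlow.

Theorem proposition3p6 (R : realType) :
  let E0 : set (heis R) := [set x | koranyi x < 1] in
  (exists u : heis R -> R, HIMCF_from E0 u) /\
  (forall u : heis R -> R, HIMCF_from E0 u ->
    forall t : R, 0 <= t ->
      M_ u t = [set x | koranyi x = expR (1 / 3 * t)]).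
Proof.
move=> E0; split; first by exists koranyi_time; exact: koranyi_flow.
by move=> u Hu t t0; exact: HIMCF_level.
Qed.
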